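(* Let $\boldsymbol k$ be an algebraically closed field with $\operatorname{char}\boldsymbol k\neq 2$, let $V$ be a vector space over $\boldsymbol k$ of finite dimension $n$, let $\mathcal C\subseteq V^*\otimes V^*\otimes V$ be the subspace of tensors fixed by the involution $\ell\otimes\ell'\otimes v\mapsto\ell'\otimes\ell\otimes v$, and let $G:=\mathrm{GL}(V)$ act naturally on $\mathcal C$. Then there exist two finite sets $\{s_p\}_{p\in P}$ and $\{t_q\}_{q\in Q}$ of nonconstant polynomial functions on $\mathcal C$ such that: (i) the closed subset $\mathcal S:=\{m\in\mathcal C\mid s_p(m)=0\ \forall p\in P\}$ is irreducible, and the map $\boldsymbol k(\mathcal C)^G\to\boldsymbol k(\mathcal S)$, $f\mapsto f|_{\mathcal S}$, is well defined and is a $\boldsymbol k$-isomorphism of fields; (ii) for every point $a$ of the open dense subset $\{m\in\mathcal C\mid t_q(m)\neq 0\ \forall q\in Q\}$ of $\mathcal C$ there exists a unique element $g\in G$ with $g\cdot a\in\mathcal S$.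
   Context: $\boldsymbol k(\mathcal C)^G$ denotes the field of $G$-invariant rational functions on $\mathcal C$; topology is the Zariski topology. *)

(* Defs.v *)
From HB Require Import structures.
From mathcomp Require Import all_boot all_order all_algebra.
From mathcomp Require Import mpoly.
Set Implicit Arguments. Unset Strict Implicit. Unset Printing Implicit Defensive.
Import Order.TTheory GRing.Theory Num.Theory.
Local Open Scope ring_scope.

(* V = k^n with standard basis e_0..e_{n-1}.  An element m of V*⊗V*⊗V is
   encoded by its coordinates c i j l, the coefficient of e_l in
   m(e_i, e_j) (m viewed as a bilinear map V × V -> V). *)
Definition tensor (k : Type) (n : nat) := 'I_n -> 'I_n -> 'I_n -> k.

Definition T3 (n : nat) := ('I_n * 'I_n * 'I_n)%type.

Definition Nvar (n : nat) : nat := #|{: T3 n}|.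

Definition ev (k : comRingType) (n : nat) (p : {mpoly k[Nvar n]})
  (c : tensor k n) : k :=
  p.@[fun r : 'I_(Nvar n) => let: (i, j, l) := enum_val r in c i j l].

Definition isC (k : Type) (n : nat) (c : tensor k n) : Prop :=
  forall i j l, c i j l = c j i l.

(* Natural action of GL(V) on V*⊗V*⊗V:
   (g.m)(u, w) = g (m (g^-1 u, g^-1 w)). *)
Definition act (k : fieldType) (n : nat) (g : 'M[k]_n) (c : tensor k n)
  : tensor k n :=
  fun i j l => \sum_(a < n) \sum_(b < n) \sum_(d < n)
      g l d * c a b d * invmx g a i * invmx g b j.

(* Polynomial functions on C are restrictions of ambient polynomials. *)
Definition nonconst_on_C (k : comRingType) (n : nat) (p : {mpoly k[Nvar n]})
  : Prop :=
  exists x y : tensor k n, isC x /\ isC y /\ ev p x != ev p y.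

Definition closedC (k : comRingType) (n : nat) (A : tensor k n -> Prop) : Prop :=
  exists F : {mpoly k[Nvar n]} -> Prop,
    forall x, A x <-> (isC x /\ forall p, F p -> ev p x = 0).

Definition zariski_irreducible (k : comRingType) (n : nat) (A : tensor k n -> Prop)
  : Prop :=
  (exists x, A x) /\
  forall Z1 Z2 : tensor k n -> Prop, closedC Z1 -> closedC Z2 ->
    (forall x, A x -> Z1 x \/ Z2 x) ->
    (forall x, A x -> Z1 x) \/ (forall x, A x -> Z2 x).

(* Rational functions on an zariski_irreducible closed X: fractions p/q of
   polynomial functions on X with q not identically zero on X ... *)
Definition nonzero_on (k : comRingType) (n : nat) (X : tensor k n -> Prop)
  (q : {mpoly k[Nvar n]}) : Prop :=
  exists x, X x /\ ev q x != 0.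

(* ... where p/q = p'/q' in k(X) iff p q' = p' q as functions on X. *)
Definition eq_on (k : comRingType) (n : nat) (X : tensor k n -> Prop)
  (p q p' q' : {mpoly k[Nvar n]}) : Prop :=
  forall x, X x -> ev p x * ev q' x = ev p' x * ev q x.

(* p/q ∈ k(C) is G-invariant: (p∘g)/(q∘g) = p/q in k(C) for all g ∈ GL(V). *)
Definition G_invariant (k : fieldType) (n : nat) (p q : {mpoly k[Nvar n]})
  : Prop :=
  forall g : 'M[k]_n, g \in unitmx -> forall x : tensor k n, isC x ->
    ev p (act g x) * ev q x = ev p x * ev q (act g x).

(* Main.v *)
(** A commutative algebra structure [c] carries canonical covariants: the trace
    form [tau x = tr (y |-> x y)], the symmetric form [beta x y = tau (x y)], the
    vector [w] with [beta w = tau], defined when [beta] is nondegenerate, and the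
    iterates [w, w w, w (w w), ...].  Let [W] be the matrix of the first [n]
    iterates.  Since [W (g c) = g W c], wherever [W] is invertible the orbit of
    [c] contains exactly one point with [W = 1], namely [W^-1 c].

    On the locus where [beta] is nondegenerate, [W = 1] is equivalent to a system
    of affine linear equations in [c].  So the slice is an affine subspace, hence
    irreducible, and composing functions on it with the rational map
    [c |-> W^-1 c] inverts the restriction of invariants. *)

Require Import Defs.
From HB Require Import structures.
From mathcomp Require Import all_boot all_order all_algebra.
From mathcomp Require Import mpoly.
From mathcomp Require Import ring zify.
From Stdlib Require Import FunctionalExtensionality PropExtensionality Classical.
Import Order.TTheory GRing.Theory Num.Theory.
Local Open Scope ring_scope.

Set Implicit Arguments.
Unset Strict Implicit.
Unset Printing Implicit Defensive.

(** * Algebras of functions *)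

Section FunctionAlgebra.
Variables (T : Type) (k : fieldType) (P : (T -> k) -> Prop).

(** Three instances occur: polynomial functions, regular functions on a subset, and functions of a
    line parameter given by a univariate polynomial. *)
Definition fun_alg : Prop :=
  [/\ forall a, P (fun=> a),
      forall f g, P f -> P g -> P (fun x => f x + g x)
    & forall f g, P f -> P g -> P (fun x => f x * g x)].

Hypothesis algP : fun_alg.

Let cstP a : P (fun=> a). Proof. by case: algP. Qed.
Let addP f g : P f -> P g -> P (fun x => f x + g x).
Proof. by case: algP => _ + _; apply. Qed.
Let mulP f g : P f -> P g -> P (fun x => f x * g x).
Proof. by case: algP => _ _; apply. Qed.

Lemma fun_alg_sum (I : Type) (r : seq I) (Q : pred I) (F : I -> T -> k) :
  (forall i, P (F i)) -> P (fun x => \sum_(i <- r | Q i) F i x).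
Proof.
move=> PF; elim: r => [|i r IHr].
  rewrite (_ : (fun _ => _) = fun=> 0); first exact: cstP.
  by apply: functional_extensionality => x; rewrite big_nil.
rewrite (_ : (fun _ => _) = fun x =>
  (if Q i then F i x else 0) + \sum_(j <- r | Q j) F j x); last first.
  apply: functional_extensionality => x; rewrite big_cons.
  by case: (Q i); rewrite ?add0r.
by apply: addP => //; case: (Q i); [exact: PF | exact: cstP].
Qed.

Lemma fun_alg_prod (I : Type) (r : seq I) (Q : pred I) (F : I -> T -> k) :
  (forall i, P (F i)) -> P (fun x => \prod_(i <- r | Q i) F i x).
Proof.
move=> PF; elim: r => [|i r IHr].
  rewrite (_ : (fun _ => _) = fun=> 1); first exact: cstP.
  by apply: functional_extensionality => x; rewrite big_nil.
rewrite (_ : (fun _ => _) = fun x =>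
  (if Q i then F i x else 1) * \prod_(j <- r | Q j) F j x); last first.
  apply: functional_extensionality => x; rewrite big_cons.
  by case: (Q i); rewrite ?mul1r.
by apply: mulP => //; case: (Q i); [exact: PF | exact: cstP].
Qed.

Lemma fun_alg_exp f m : P f -> P (fun x => f x ^+ m).
Proof.
move=> Pf; rewrite (_ : (fun _ => _) = fun x => \prod_(i < m) f x).
  exact: fun_alg_prod.
by apply: functional_extensionality => x; rewrite prodr_const card_ord.
Qed.

Lemma fun_alg_mulmx m n p (A : T -> 'M[k]_(m, n)) (B : T -> 'M[k]_(n, p)) i j :
  (forall i' j', P (fun x => A x i' j')) ->
  (forall i' j', P (fun x => B x i' j')) -> P (fun x => (A x *m B x) i j).
Proof.
move=> PA PB.
rewrite (_ : (fun _ => _) = fun x => \sum_l A x i l * B x l j).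
  by apply: fun_alg_sum => l; apply: mulP.
by apply: functional_extensionality => x; rewrite mxE.
Qed.

Lemma fun_alg_det n (A : T -> 'M[k]_n) :
  (forall i j, P (fun x => A x i j)) -> P (fun x => \det (A x)).
Proof.
move=> PA; rewrite /determinant; apply: fun_alg_sum => s.
by apply: mulP => //; apply: fun_alg_prod.
Qed.

(** By Cramer's rule, an entry of the inverse is a signed minor times the inverse determinant. *)
Lemma fun_alg_invmx n (A : T -> 'M[k]_n) i j :
  (forall x, A x \in unitmx) -> P (fun x => (\det (A x))^-1) ->
  (forall i j, P (fun x => A x i j)) -> P (fun x => invmx (A x) i j).
Proof.
move=> uA PV PA; rewrite (_ : (fun _ => _) = fun x =>
  (\det (A x))^-1 * ((-1) ^+ (j + i) * \det (row' j (col' i (A x))))).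
  apply: mulP => //; apply: mulP => //; apply: fun_alg_det => a b.
  by rewrite (_ : (fun _ => _) = fun x => A x (lift j a) (lift i b)) //;
     apply: functional_extensionality => x; rewrite !mxE.
by apply: functional_extensionality => x; rewrite /invmx uA !mxE.
Qed.

Lemma fun_alg_ev n (f : T -> tensor k n) (p : {mpoly k[Nvar n]}) :
  (forall i j l, P (fun x => f x i j l)) -> P (fun x => ev p (f x)).
Proof.
move=> Pf; rewrite (_ : (fun _ => _) = fun x => \sum_(m <- msupp p) p@_m *
    \prod_r (let: (i, j, l) := enum_val r in f x i j l) ^+ m r).
  apply: fun_alg_sum => m; apply: mulP => //; apply: fun_alg_prod => r.
  by apply: fun_alg_exp; case: (enum_val r) => -[].
by apply: functional_extensionality => x; rewrite /ev mevalE.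
Qed.

End FunctionAlgebra.

(** * Polynomial functions and regular functions on a subset *)

Section PolynomialFunctions.
Variables (k : fieldType) (n : nat).
Implicit Types (f g : tensor k n -> k) (U : tensor k n -> Prop).

Definition coordX (i j l : 'I_n) : {mpoly k[Nvar n]} :=
  'X_(enum_rank (i, j, l)).

Lemma ev_coordX i j l (c : tensor k n) : ev (coordX i j l) c = c i j l.
Proof. by rewrite /ev mevalXU enum_rankK. Qed.

Lemma evD (p q : {mpoly k[Nvar n]}) c : ev (p + q) c = ev p c + ev q c.
Proof. exact: mevalD. Qed.

Lemma evB (p q : {mpoly k[Nvar n]}) c : ev (p - q) c = ev p c - ev q c.
Proof. exact: mevalB. Qed.

Lemma evM (p q : {mpoly k[Nvar n]}) c : ev (p * q) c = ev p c * ev q c.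
Proof. exact: mevalM. Qed.

Definition evE := (evB, evD, evM, ev_coordX).

Definition polyfun f : Prop := exists p, forall c, ev p c = f c.

Lemma polyfun_alg : fun_alg polyfun.
Proof.
split=> [a | f g [p pE] [q qE] | f g [p pE] [q qE]].
- by exists a%:MP => c; rewrite /ev mevalC.
- by exists (p + q) => c; rewrite evD pE qE.
- by exists (p * q) => c; rewrite evM pE qE.
Qed.

Lemma polyfun_coord i j l : polyfun (fun c => c i j l).
Proof. by exists (coordX i j l) => c; rewrite ev_coordX. Qed.

(** A single global fraction serves all of [U]. The subtype as domain leaves the function
    unspecified where [q] may vanish. *)
Definition regular U (f : {c | U c} -> k) : Prop :=
  exists p q, forall c, ev q (sval c) != 0 /\ f c = ev p (sval c) / ev q (sval c).

Lemma polyfun_regular U f : polyfun f -> regular (fun c : {c | U c} => f (sval c)).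
Proof.
case=> p pE; exists p, 1 => c; rewrite /ev mevalC.
by rewrite oner_eq0 divr1 -pE.
Qed.

Lemma regular_alg U : fun_alg (@regular U).
Proof.
split=> [a | f g [p [q pq]] [r [s rs]] | f g [p [q pq]] [r [s rs]]].
- by apply: (@polyfun_regular U (fun=> a)); case: polyfun_alg.
- exists (p * s + r * q), (q * s) => c; rewrite !evE.
  have [q0 ->] := pq c; have [s0 ->] := rs c.
  by rewrite mulf_neq0 // addf_div.
- exists (p * r), (q * s) => c; rewrite !evE.
  have [q0 ->] := pq c; have [s0 ->] := rs c.
  by rewrite mulf_neq0 // mulf_div.
Qed.

Lemma regular_inv U (f : {c | U c} -> k) :
  (forall c, f c != 0) -> regular f -> regular (fun c => (f c)^-1).
Proof.
move=> f0 [p [q pq]]; exists q, p => c.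
have [q0 fE] := pq c; split; last by rewrite fE invf_div.
by apply: contraNneq (f0 c) => p0; rewrite fE p0 mul0r.
Qed.

End PolynomialFunctions.

(** * Irreducibility of affine subspaces *)

Section Lines.
Variables (k : closedFieldType) (n : nat).
Implicit Types (x y : tensor k n) (A : tensor k n -> Prop).

Definition line x y (t : k) : tensor k n :=
  fun i j l => x i j l + t * (y i j l - x i j l).

Definition line_closed A : Prop := forall x y t, A x -> A y -> A (line x y t).

Lemma line0 x y : line x y 0 = x.
Proof.
by do 3!apply: functional_extensionality => ?; rewrite /line mul0r addr0.
Qed.

Lemma line1 x y : line x y 1 = y.
Proof.
by do 3!apply: functional_extensionality => ?; rewrite /line mul1r addrC subrK.
Qed.

Lemma ev_line p x y : exists P : {poly k}, forall t, P.[t] = ev p (line x y t).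
Proof.
apply: (@fun_alg_ev _ _ (fun f => exists P : {poly k}, forall t, P.[t] = f t)).
  split=> [a | f g [P PE] [Q QE] | f g [P PE] [Q QE]].
  - by exists a%:P => t; rewrite hornerC.
  - by exists (P + Q) => t; rewrite hornerD PE QE.
  - by exists (P * Q) => t; rewrite hornerM PE QE.
move=> i j l; exists ((x i j l)%:P + 'X * (y i j l - x i j l)%:P) => t.
by rewrite !hornerE.
Qed.

(** On the line joining the two witnesses both factors become nonzero univariate polynomials, and
    over an algebraically closed field their product has a nonroot. *)
Lemma nonzero_onM A p q : line_closed A ->
  nonzero_on A p -> nonzero_on A q -> nonzero_on A (p * q).
Proof.
move=> lineA [x [Ax px]] [y [Ay qy]].
have [P PE] := ev_line p x y; have [Q QE] := ev_line q x y.
have P0 : P != 0.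
  by apply: contraNneq px => P0; rewrite -(line0 x y) -PE P0 horner0.
have Q0 : Q != 0.
  by apply: contraNneq qy => Q0; rewrite -(line1 x y) -QE Q0 horner0.
have /closed_nonrootP[t] : P * Q != 0 by rewrite mulf_neq0.
rewrite rootE hornerM PE QE -evM => pqt.
by exists (line x y t); split=> //; apply: lineA.
Qed.

(** If [A] lay in neither closed set, each would have an equation that is nonzero somewhere on [A].
    By [nonzero_onM] both are nonzero at a common point, which the covering then fails to
    contain. *)
Lemma line_closed_irreducible A :
  (exists x, A x) -> line_closed A -> zariski_irreducible A.
Proof.
move=> A0 lineA; split=> // Z1 Z2 [F1 F1P] [F2 F2P] A12; apply: NNPP.
case/not_or_and=> /not_all_ex_not[x1 AZ1] /not_all_ex_not[x2 AZ2].
have [Ax1 Zx1] := imply_to_and _ _ AZ1; have [Ax2 Zx2] := imply_to_and _ _ AZ2.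
have CA x : A x -> isC x by move=> /A12[/F1P[]|/F2P[]].
have sep Z F x : (forall x, Z x <-> isC x /\ forall p, F p -> ev p x = 0) ->
    A x -> ~ Z x -> exists2 p, F p & nonzero_on A p.
  move=> ZP Ax Zx; have : ~ forall p, F p -> ev p x = 0.
    by move=> Fx; apply/Zx/ZP; split=> //; apply: CA.
  case/not_all_ex_not=> p Fpx; have [Fp px] := imply_to_and _ _ Fpx.
  by exists p => //; exists x; split=> //; apply/eqP.
have [p1 F1p p1A] := sep _ _ _ F1P Ax1 Zx1.
have [p2 F2p p2A] := sep _ _ _ F2P Ax2 Zx2.
have [x [Ax]] := nonzero_onM lineA p1A p2A; rewrite evM.
case: (A12 x Ax) => [/F1P[_ Fx]|/F2P[_ Fx]].
  by rewrite (Fx p1) // mul0r eqxx.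
by rewrite (Fx p2) // mulr0 eqxx.
Qed.

Lemma isC_line_closed : line_closed (@isC k n).
Proof. by move=> x y t Cx Cy i j l; rewrite /line Cx Cy. Qed.

End Lines.

(** * Covariants *)

Lemma invmx_mul (R : comUnitRingType) n (A B : 'M[R]_n) :
  A \in unitmx -> B \in unitmx -> invmx (A *m B) = invmx B *m invmx A.
Proof.
move=> uA uB; have uAB : A *m B \in unitmx by rewrite unitmx_mul uA.
by rewrite -[RHS](mulKmx uAB) -mulmxA (mulKVmx uB) mulmxV // mulmx1.
Qed.

Section Covariants.
Variables (k : fieldType) (n : nat).
Implicit Types (c : tensor k n) (g h : 'M[k]_n) (u v : 'cV[k]_n).

(** This is the bilinear form giving coordinate [l] of the product. It is a slice of the array, not
    the slice of the group action, which is [in_slice]. *)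
Definition slice c (l : 'I_n) : 'M[k]_n := \matrix_(i, j) c i j l.

Definition trace_form c : 'rV[k]_n := \row_i \sum_j c i j j.

Definition gram c : 'M[k]_n := \sum_l trace_form c 0 l *: slice c l.

(** Since [invmx] returns a singular matrix unchanged, this is the vector w only where [gram c] is
    invertible. *)
Definition dual_vec c : 'cV[k]_n := invmx (gram c) *m (trace_form c)^T.

Definition mulv c u v : 'cV[k]_n := \col_l (u^T *m slice c l *m v) 0 0.

Definition krylov c : 'M[k]_n :=
  \matrix_(l, i) iter i (mulv c (dual_vec c)) (dual_vec c) l 0.

Lemma sliceP c c' : slice c =1 slice c' -> c = c'.
Proof.
move=> cc'; apply: functional_extensionality => i.
apply: functional_extensionality => j; apply: functional_extensionality => l.
by move: (cc' l) => /matrixP/(_ i j); rewrite !mxE.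
Qed.

Lemma slice_act g c l : slice (act g c) l =
  \sum_d g l d *: ((invmx g)^T *m slice c d *m invmx g).
Proof.
apply/matrixP=> i j; rewrite mxE summxE /act.
under eq_bigr do rewrite exchange_big /=.
rewrite exchange_big /=; apply: eq_bigr => d _; rewrite !mxE mulr_sumr.
rewrite exchange_big /=; apply: eq_bigr => b _; rewrite !mxE mulr_suml mulr_sumr.
by apply: eq_bigr => a _; rewrite !mxE; ring.
Qed.

Lemma act1 c : act 1%:M c = c.
Proof.
apply: sliceP => l; rewrite slice_act (bigD1 l) //= big1 ?addr0.
  by rewrite mxE eqxx scale1r invmx1 trmx1 mul1mx mulmx1.
by move=> d dl; rewrite mxE eq_sym (negPf dl) scale0r.
Qed.

Lemma actM g h c : g \in unitmx -> h \in unitmx ->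
  act g (act h c) = act (g *m h) c.
Proof.
move=> ug uh; apply: sliceP => l; rewrite !slice_act.
under eq_bigr do rewrite slice_act mulmx_sumr mulmx_suml scaler_sumr.
rewrite exchange_big /=; apply: eq_bigr => d _.
rewrite mxE scaler_suml; apply: eq_bigr => e _.
by rewrite -scalemxAr -scalemxAl scalerA invmx_mul // trmx_mul !mulmxA.
Qed.

Lemma actVK g c : g \in unitmx -> act g (act (invmx g) c) = c.
Proof. by move=> ug; rewrite actM ?unitmx_inv // mulmxV // act1. Qed.

Lemma isC_act g c : isC c -> isC (act g c).
Proof.
move=> Cc i j l; rewrite /act exchange_big /=; apply: eq_bigr => a _.
apply: eq_bigr => b _; apply: eq_bigr => d _; rewrite Cc; ring.
Qed.

Lemma trace_form_act g c : g \in unitmx ->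
  trace_form (act g c) = trace_form c *m invmx g.
Proof.
move=> ug; apply/rowP=> i; rewrite !mxE.
(* Summing the diagonal over the output index multiplies each slice on the right by [g], which
   cancels [invmx g]. *)
transitivity (\sum_d ((invmx g)^T *m slice c d *m invmx g *m g) i d).
  transitivity (\sum_j slice (act g c) j i j).
    by apply: eq_bigr => j _; rewrite [RHS]mxE.
  under eq_bigr do rewrite slice_act summxE.
  rewrite exchange_big /=; apply: eq_bigr => d _; rewrite [RHS]mxE.
  by apply: eq_bigr => j _; rewrite mxE mulrC.
under eq_bigr => d _ do rewrite -mulmxA mulVmx // mulmx1 mxE.
rewrite exchange_big /=; apply: eq_bigr => a _; rewrite !mxE mulr_suml.
by apply: eq_bigr => d _; rewrite !mxE mulrC.
Qed.

Lemma gram_act g c : g \in unitmx ->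
  gram (act g c) = (invmx g)^T *m gram c *m invmx g.
Proof.
move=> ug; rewrite /gram trace_form_act // mulmx_sumr mulmx_suml.
under eq_bigr do rewrite slice_act scaler_sumr.
rewrite exchange_big /=; apply: eq_bigr => d _.
under eq_bigr do rewrite scalerA.
rewrite -scaler_suml -scalemxAr -scalemxAl; congr (_ *: _).
have /rowP/(_ d) : trace_form c *m invmx g *m g = trace_form c.
  by rewrite -mulmxA mulVmx // mulmx1.
by rewrite mxE.
Qed.

Lemma gram_unit_act g c : g \in unitmx ->
  (gram (act g c) \in unitmx) = (gram c \in unitmx).
Proof.
by move=> ug; rewrite gram_act // !unitmx_mul unitmx_tr unitmx_inv ug /= andbT.
Qed.

Lemma dual_vec_act g c : g \in unitmx -> gram c \in unitmx ->
  dual_vec (act g c) = g *m dual_vec c.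
Proof.
move=> ug uc; have ugV : invmx g \in unitmx by rewrite unitmx_inv.
rewrite /dual_vec gram_act // trace_form_act // trmx_mul.
rewrite !invmx_mul ?unitmx_mul ?unitmx_tr ?ugV ?uc //.
by rewrite invmxK -!mulmxA mulKmx ?unitmx_tr.
Qed.

Lemma mulv_act g c u v : g \in unitmx ->
  mulv (act g c) (g *m u) (g *m v) = g *m mulv c u v.
Proof.
move=> ug; apply/colP=> l; rewrite [LHS]mxE [RHS]mxE slice_act.
rewrite mulmx_sumr mulmx_suml summxE.
apply: eq_bigr => d _; rewrite -scalemxAr -scalemxAl mxE [mulv c u v d 0]mxE.
congr (_ * (_ : 'M_1) 0 0).
by rewrite trmx_mul -!mulmxA mulKmx // trmx_inv mulKVmx ?unitmx_tr.
Qed.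

(** Covariance of [mulv] carries [g] through every iterate. *)
Lemma krylov_act g c : g \in unitmx -> gram c \in unitmx ->
  krylov (act g c) = g *m krylov c.
Proof.
move=> ug uc; have iterE i :
    iter i (mulv (act g c) (dual_vec (act g c))) (dual_vec (act g c)) =
    g *m iter i (mulv c (dual_vec c)) (dual_vec c).
  by rewrite dual_vec_act //; elim: i => //= i ->; rewrite mulv_act.
apply/matrixP=> l i; rewrite !mxE iterE mxE.
by apply: eq_bigr => j _; rewrite mxE.
Qed.

Definition generic_pt c : Prop := gram c \in unitmx /\ krylov c \in unitmx.

Lemma generic_act g c : g \in unitmx -> generic_pt c -> generic_pt (act g c).
Proof.
move=> ug [uc uW]; split; first by rewrite gram_unit_act.
by rewrite krylov_act // unitmx_mul ug.
Qed.

Definition normal_form c : tensor k n := act (invmx (krylov c)) c.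

Lemma normal_form_act g c : g \in unitmx -> generic_pt c ->
  normal_form (act g c) = normal_form c.
Proof.
move=> ug [uc uW]; rewrite /normal_form krylov_act // invmx_mul //.
by rewrite actM ?unitmx_mul ?unitmx_inv ?ug ?uW // -mulmxA mulVmx ?mulmx1.
Qed.

End Covariants.

(** * Regularity of the covariants and of the normal form *)

Section Regularity.
Variables (k : fieldType) (n : nat).

Lemma polyfun_trace_form i : @polyfun k n (fun c => trace_form c 0 i).
Proof.
rewrite (_ : (fun _ => _) = fun c => \sum_j c i j j).
  by apply: (fun_alg_sum (@polyfun_alg _ _)) => j; apply: polyfun_coord.
by apply: functional_extensionality => c; rewrite mxE.
Qed.

Lemma polyfun_gram i j : @polyfun k n (fun c => gram c i j).
Proof.
rewrite (_ : (fun _ => _) = fun c => \sum_l trace_form c 0 l * c i j l).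
  apply: (fun_alg_sum (@polyfun_alg _ _)) => l.
  case: (@polyfun_alg k n) => _ _; apply; last exact: polyfun_coord.
  exact: polyfun_trace_form.
apply: functional_extensionality => c; rewrite summxE.
by apply: eq_bigr => l _; rewrite !mxE.
Qed.

Lemma polyfun_det_gram : @polyfun k n (fun c => \det (gram c)).
Proof. by apply: (fun_alg_det (@polyfun_alg _ _)); apply: polyfun_gram. Qed.

Variable U : tensor k n -> Prop.
Hypothesis gramU : forall c, U c -> gram c \in unitmx.

(** The only division is by the Gram determinant. The set [U] stays general because it serves both
    as the generic locus and as the larger locus where only the Gram matrix is invertible. *)
Lemma regular_krylov i j :
  regular (fun c : {c | U c} => krylov (sval c) i j).
Proof.
have regC a b d : regular (fun c : {c | U c} => sval c a b d).
  exact: (@polyfun_regular _ _ U _ (polyfun_coord k a b d)).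
have regw l : regular (fun c : {c | U c} => dual_vec (sval c) l 0).
  apply: (fun_alg_mulmx (regular_alg U)) => a b; last first.
    rewrite (_ : (fun _ => _) = fun c : {c | U c} => trace_form (sval c) 0 a).
      exact: (@polyfun_regular _ _ U _ (polyfun_trace_form a)).
    by apply: functional_extensionality => c; rewrite mxE ord1.
  apply: (fun_alg_invmx (regular_alg U)) => [[c Uc]||a' b'].
  - exact: gramU.
  - apply: regular_inv; last exact: (@polyfun_regular _ _ U _ polyfun_det_gram).
    by case=> c Uc; rewrite -unitfE -unitmxE gramU.
  - exact: (@polyfun_regular _ _ U _ (polyfun_gram a' b')).
rewrite (_ : (fun _ => _) = fun c : {c | U c} =>
  iter j (mulv (sval c) (dual_vec (sval c))) (dual_vec (sval c)) i 0); last first.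
  by apply: functional_extensionality => c; rewrite mxE.
(* The row [i] is generalised, since one row of an iterate involves all rows of the previous one. *)
elim: {j}(nat_of_ord j) i => [//|j IHj] i /=.
rewrite (_ : (fun _ => _) = fun c : {c | U c} =>
  ((dual_vec (sval c))^T *m slice (sval c) i *m
   iter j (mulv (sval c) (dual_vec (sval c))) (dual_vec (sval c))) 0 0);
  last by apply: functional_extensionality => c; rewrite mxE.
apply: (fun_alg_mulmx (regular_alg U)) => a b; last by rewrite ord1; apply: IHj.
apply: (fun_alg_mulmx (regular_alg U)) => {}a {}b.
  rewrite (_ : (fun _ => _) = fun c : {c | U c} => dual_vec (sval c) b 0) //.
  by apply: functional_extensionality => c; rewrite mxE ord1.
rewrite (_ : (fun _ => _) = fun c : {c | U c} => sval c a b i) //.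
by apply: functional_extensionality => c; rewrite mxE.
Qed.

End Regularity.

Lemma regular_ev_normal_form (k : fieldType) n (p : {mpoly k[Nvar n]}) :
  regular (fun c : {c : tensor k n | generic_pt c} => ev p (normal_form (sval c))).
Proof.
have gU (c : tensor k n) : generic_pt c -> gram c \in unitmx by case.
have regW := regular_krylov gU; have algU := regular_alg (@generic_pt k n).
have regV i j :
    regular (fun c : {c : tensor k n | generic_pt c} => invmx (krylov (sval c)) i j).
  apply: (fun_alg_invmx algU) => // [[c []] //|].
  apply: regular_inv; last exact: (fun_alg_det algU).
  by case=> c [uc uW]; rewrite -unitfE -unitmxE.
apply: (fun_alg_ev algU) => i j l.
(* Acting by the inverse of W puts W itself on both inputs, so only the output index carries an
   inverse. *)
rewrite (_ : (fun _ => _) = fun c : {c | generic_pt c} =>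
  \sum_a \sum_b \sum_d invmx (krylov (sval c)) l d * sval c a b d
    * krylov (sval c) a i * krylov (sval c) b j); last first.
  by apply: functional_extensionality => c; rewrite /normal_form /act invmxK.
have [_ _ mulP] := algU.
apply: (fun_alg_sum algU) => a; apply: (fun_alg_sum algU) => b.
apply: (fun_alg_sum algU) => d; do 3!apply: (mulP) => //.
exact: (@polyfun_regular _ _ _ _ (polyfun_coord k a b d)).
Qed.

(** * The slice *)

Section Slice.
Variables (k : fieldType) (m : nat).
Local Notation n := m.+1.
Implicit Types c : tensor k n.

Definition cur (j : 'I_m) : 'I_n := widen_ord (leqnSn m) j.
Definition nxt (j : 'I_m) : 'I_n := lift ord0 j.

Definition in_slice c : Prop :=
  [/\ isC c,
      forall j l, c ord0 (cur j) l = (l == nxt j)%:R,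
      forall j, trace_form c 0 (cur j) = trace_form c 0 (nxt j)
    & \sum_l c ord0 ord_max l = 1].

Lemma mulvE c u v l : mulv c u v l 0 = \sum_i \sum_j u i 0 * c i j l * v j 0.
Proof.
rewrite mxE mxE exchange_big /=; apply: eq_bigr => j _.
by rewrite mxE mulr_suml; apply: eq_bigr => i _; rewrite !mxE.
Qed.

Lemma mulv_delta c i j l :
  mulv c (delta_mx i 0) (delta_mx j 0) l 0 = c i j l.
Proof.
rewrite mulvE (bigD1 i) //= [X in _ + X]big1 ?addr0 => [|a ai].
  rewrite (bigD1 j) //= big1 ?addr0 => [|b bj].
    by rewrite !mxE !eqxx mul1r mulr1.
  by rewrite !mxE (negPf bj) !mulr0.
by rewrite big1 // => b _; rewrite !mxE (negPf ai) !mul0r.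
Qed.

(** The predicate lives on [nat] so that the induction applies to statements about [iter i] and
    [inord i]. *)
Lemma nat_cur_nxt (P : nat -> Prop) :
  P 0%N -> (forall j : 'I_m, P (cur j) -> P (nxt j)) ->
  forall i : 'I_n, P i.
Proof.
move=> P0 PS [i /=]; elim: i => // i IHi lt_i.
have lt_im : (i < m)%N by [].
by have := PS (Ordinal lt_im); apply; apply: IHi; apply: ltnW.
Qed.

Lemma trace_form_constant c :
  (forall j, trace_form c 0 (cur j) = trace_form c 0 (nxt j)) ->
  forall i, trace_form c 0 i = trace_form c 0 ord0.
Proof.
move=> tc i; rewrite -[in LHS](inord_val i).
apply: (nat_cur_nxt (P := fun i => trace_form c 0 (inord i) = trace_form c 0 ord0)).
  by congr (trace_form c 0 _); apply: val_inj; rewrite /= inordK.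
by move=> j; rewrite !inord_val tc.
Qed.

Lemma gram_delta c : isC c ->
  gram c *m delta_mx ord0 0 = \col_j \sum_l c ord0 j l * trace_form c 0 l.
Proof.
move=> Cc; rewrite -colE; apply/colP=> j; rewrite !mxE summxE.
by apply: eq_bigr => l _; rewrite !mxE Cc mulrC.
Qed.

(* The conditions defining the slice say that [e_0] is the dual vector and
   [e_0 e_j = e_(j+1)]: the dual vector condition at [e_(n-1)] is quadratic in
   the coordinates, but becomes affine after cancelling the common nonzero
   value of the trace form on the basis. *)
Lemma in_sliceP c : isC c -> gram c \in unitmx ->
  in_slice c <-> krylov c = 1%:M.
Proof.
move=> Cc uc; split=> [[_ c0 tc cl] | W1].
  have tE := trace_form_constant tc.
  have w0 : dual_vec c = delta_mx ord0 0.
    rewrite /dual_vec; apply: (canLR (mulKmx uc)); rewrite gram_delta //.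
    apply/colP=> j; rewrite [LHS]mxE [RHS]mxE.
    under eq_bigr do rewrite tE; rewrite -mulr_suml tE.
    suff -> : \sum_l c ord0 j l = 1 by rewrite mul1r.
    (* Below the last index, e_0 e_j is a basis vector; at the last index the sum is the final slice
       condition. *)
    case: (unliftP ord_max j) => [i ->|-> //].
    have -> : lift ord_max i = cur i by apply: val_inj; exact: lift_max.
    under eq_bigr do rewrite c0.
    by rewrite (bigD1 (nxt i)) //= eqxx big1 ?addr0 // => l /negPf ->.
  apply/matrixP=> l i; rewrite !mxE w0.
  suff -> : iter i (mulv c (delta_mx ord0 0)) (delta_mx ord0 0) =
            delta_mx (inord i) 0 by rewrite mxE inord_val andbT.
  apply: (nat_cur_nxt (P := fun i => iter i (mulv c (delta_mx ord0 0))
    (delta_mx ord0 0) = delta_mx (inord i) 0)) => [|j IHj].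
    by congr delta_mx; apply: val_inj; rewrite /= inordK.
  rewrite lift0 iterS IHj !inord_val; apply/colP=> a.
  by rewrite mulv_delta c0 !mxE andbT -lift0 inord_val.
have colW (i : 'I_n) :
    iter i (mulv c (dual_vec c)) (dual_vec c) = delta_mx i 0.
  apply/colP=> l; move/matrixP/(_ l i): W1; rewrite !mxE => ->.
  by rewrite andbT.
have w0 : dual_vec c = delta_mx ord0 0 by rewrite -(colW ord0).
have c0 j l : c ord0 (cur j) l = (l == nxt j)%:R.
  rewrite -mulv_delta -w0 -colW -iterS.
  (* The value of [nxt j] is [(cur j).+1] by computation, so this iterate is column [nxt j] of the
     identity. *)
  rewrite -[(cur j).+1]/(nat_of_ord (Ordinal (ltn_ord (nxt j)))).
  by rewrite colW mxE andbT.
(* This is the defining equation of the dual vector, read with w = e_0. *)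
have tE j : trace_form c 0 j = \sum_l c ord0 j l * trace_form c 0 l.
  have : gram c *m dual_vec c = (trace_form c)^T by rewrite mulKVmx.
  by rewrite w0 gram_delta // => /colP/(_ j); rewrite mxE [in RHS]mxE => <-.
have tc j : trace_form c 0 (cur j) = trace_form c 0 (nxt j).
  rewrite tE (bigD1 (nxt j)) //= c0 eqxx mul1r big1 ?addr0 // => l /negPf lj.
  by rewrite c0 lj mul0r.
have tE0 := trace_form_constant tc.
(* The remaining condition is [tE] at the last index divided by the common trace. Were that trace
   zero, the dual vector would vanish instead of being e_0. *)
split=> //; apply: (@mulIf _ (trace_form c 0 ord0)).
  apply/eqP=> t0.
  have tc0 : trace_form c = 0 by apply/rowP=> i; rewrite tE0 t0 mxE.
  move/colP/(_ ord0): w0; rewrite /dual_vec tc0 trmx0 mulmx0 !mxE eqxx.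
  by move/esym/eqP; rewrite oner_eq0.
rewrite mul1r -[RHS](tE0 ord_max) [RHS]tE mulr_suml.
by apply: eq_bigr => l _; rewrite tE0.
Qed.

Lemma generic_in_slice c : isC c -> generic_pt c -> in_slice (normal_form c).
Proof.
move=> Cc gc; have [uc uW] := gc.
have uV : invmx (krylov c) \in unitmx by rewrite unitmx_inv.
apply/in_sliceP; first exact: isC_act.
  by rewrite gram_unit_act.
by rewrite krylov_act // mulVmx.
Qed.

Lemma normal_form_slice c : in_slice c -> generic_pt c -> normal_form c = c.
Proof.
move=> Sc [uc uW]; rewrite /normal_form.
have [Cc _ _ _] := Sc; move/in_sliceP: Sc => /(_ Cc uc) ->.
by rewrite invmx1 act1.
Qed.

(** Membership in the slice forces [g *m krylov a] to be the identity. *)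
Lemma generic_unique a g : isC a -> generic_pt a -> g \in unitmx ->
  in_slice (act g a) -> g = invmx (krylov a).
Proof.
move=> Ca ga ug; have [uc uW] := ga.
move/in_sliceP=> /(_ (isC_act g Ca)); rewrite gram_unit_act // => /(_ uc).
by rewrite krylov_act // => gW; rewrite -[LHS](mulmxK uW) gW mul1mx.
Qed.

(** * A generic point of the slice *)

Lemma sum_delta (a : 'I_n) : \sum_l (l == a)%:R = 1 :> k.
Proof. by rewrite (bigD1 a) //= eqxx big1 ?addr0 // => l /negPf ->. Qed.

(* [e_0 e_j = e_(j+1)] with [e_0 e_(n-1) = e_(n-1)], [e_i e_i = e_i - e_0] and
   [e_i e_j = e_0] for distinct [i, j > 0]; every trace is [1] and the Gram
   matrix is all ones minus [diag(0, 1, ..., 1)]. *)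
Definition model_succ (j : 'I_n) : 'I_n := inord (minn j.+1 m).

Definition model : tensor k n := fun i j l =>
  if i == 0 then (l == model_succ j)%:R
  else if j == 0 then (l == model_succ i)%:R
  else if i == j then (l == i)%:R - (l == 0)%:R else (l == 0)%:R.

Lemma model_succE (j : 'I_n) : model_succ j = minn j.+1 m :> nat.
Proof. by rewrite inordK // ltnS geq_minr. Qed.

Lemma isC_model : isC model.
Proof.
move=> i j l; rewrite /model [j == i]eq_sym.
by case: (eqVneq i 0) => [i0|_]; case: (eqVneq j 0) => [j0|_] //;
   [rewrite i0 j0 | case: (i =P j) => [->|]].
Qed.

Lemma trace_form_model i : trace_form model 0 i = 1.
Proof.
rewrite mxE /model; case: (eqVneq i 0) => [_|i0].
  (* The last index is the only fixed point of [model_succ]. *)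
  rewrite -[RHS](sum_delta ord_max); apply: eq_bigr => j _; congr (_%:R).
  rewrite -!val_eqE /= model_succE minnE.
  by have := ltn_ord j; lia.
(* Only [j = i] contributes. The term [j = 0] vanishes because a nonzero [i] forces [m > 0], so that
   [model_succ i] is nonzero. *)
rewrite (bigD1 i) //= (negPf i0) !eqxx subr0 big1 ?addr0 // => j ji.
case: (eqVneq j 0) => [->|j0]; last by rewrite eq_sym (negPf ji).
suff /negPf -> : 0 != model_succ i by [].
rewrite -val_eqE /= model_succE; move: i0; rewrite -val_eqE /= => i0.
by have := ltn_ord i; lia.
Qed.

Lemma model_in_slice : in_slice model.
Proof.
split=> [|j l|j|]; first exact: isC_model.
- rewrite /model eqxx; congr ((l == _)%:R); apply: val_inj.
  by rewrite /= model_succE /bump /=; have := ltn_ord j; lia.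
- by rewrite !trace_form_model.
- by rewrite /model eqxx sum_delta.
Qed.

(** As all traces are 1, an entry is the coordinate sum of a product: 0 for e_i - e_0 and 1 for a
    basis vector. *)
Lemma gram_modelE i j :
  gram model i j = 1 - ((i != 0) && (i == j))%:R.
Proof.
rewrite summxE; under eq_bigr do rewrite mxE trace_form_model mul1r mxE.
rewrite /model; case: (eqVneq i 0) => [_|i0] /=; first by rewrite sum_delta subr0.
case: (eqVneq i j) i0 => [<-|ij] i0.
  by rewrite (negPf i0) sumrB !sum_delta !subrr.
by case: (j == 0); rewrite sum_delta subr0.
Qed.

(** For [v] in the kernel, column 0 says that the entries sum to zero. The other columns then kill
    every [v 0 j] with [j != 0], and the sum kills [v 0 0], in any characteristic. *)
Lemma gram_model_unit : gram model \in unitmx.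
Proof.
rewrite unitmxE unitfE; apply/det0P => -[v v0 vG]; case/eqP: v0.
have vE j : \sum_i v 0 i = (j != 0)%:R * v 0 j.
  move/rowP/(_ j): vG; rewrite !mxE.
  under eq_bigr do rewrite gram_modelE mulrBr mulr1; rewrite sumrB => /subr0_eq ->.
  rewrite (bigD1 j) //= eqxx andbT big1 ?addr0 1?mulrC // => i /negPf ->.
  by rewrite andbF mulr0.
have v0 j : j != 0 -> v 0 j = 0.
  by move=> j0; have := vE j; rewrite j0 mul1r (vE 0) eqxx mul0r.
apply/rowP=> j; rewrite mxE; case: (eqVneq j 0) => [->|/v0 //].
by have := vE 0; rewrite eqxx mul0r (bigD1 0) //= big1 ?addr0 // => i /v0.
Qed.

(** This point shows that the generic locus is nonempty and meets the slice, on which the later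
    density arguments rest. *)
Lemma model_generic : generic_pt model.
Proof.
have uG := gram_model_unit; split=> //.
by move/in_sliceP: model_in_slice => ->//; rewrite ?unitmx1 //; apply: isC_model.
Qed.

(** * Polynomial equations of the slice and of the generic locus *)

Definition traceX (i : 'I_n) : {mpoly k[Nvar n]} := \sum_j coordX k i j j.

Definition slice_eqs : seq {mpoly k[Nvar n]} :=
  [seq coordX k ord0 (cur p.1) p.2 - (p.2 == nxt p.1)%:R%:MP
     | p : 'I_m * 'I_n] ++
  [seq traceX (cur j) - traceX (nxt j) | j : 'I_m] ++
  [:: \sum_l coordX k ord0 ord_max l - 1%:MP].

Lemma evC (a : k) c : ev a%:MP c = a.
Proof. exact: mevalC. Qed.

Lemma ev_sum (I : finType) (F : I -> {mpoly k[Nvar n]}) c :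
  ev (\sum_i F i) c = \sum_i ev (F i) c.
Proof.
by apply: (big_morph (fun p => ev p c)) => [p q|]; [exact: evD | exact: meval0].
Qed.

Lemma ev_traceX i c : ev (traceX i) c = trace_form c 0 i.
Proof. by rewrite ev_sum mxE; apply: eq_bigr => j _; rewrite ev_coordX. Qed.

Lemma ev_sum_coordX i j c : ev (\sum_l coordX k i j l) c = \sum_l c i j l.
Proof. by rewrite ev_sum; apply: eq_bigr => l _; rewrite ev_coordX. Qed.

Lemma slice_eqsP c :
  isC c /\ (forall p, p \in slice_eqs -> ev p c = 0) <-> in_slice c.
Proof.
split=> [[Cc c0] | [Cc c0 tc cl]].
  split=> // [j l|j|].
  - have := c0 (coordX k ord0 (cur j) l - (l == nxt j)%:R%:MP).
    rewrite evB evC ev_coordX => /(_ _)/subr0_eq -> //.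
    by rewrite mem_cat (image_f _ (x := (j, l))).
  - have := c0 (traceX (cur j) - traceX (nxt j)).
    rewrite evB !ev_traceX => /(_ _)/subr0_eq -> //.
    by rewrite !mem_cat (image_f _ (x := j)) ?orbT.
  - have := c0 (\sum_l coordX k ord0 ord_max l - 1%:MP).
    rewrite evB evC ev_sum_coordX.
    by move=> /(_ _)/subr0_eq -> //; rewrite !mem_cat mem_head !orbT.
split=> // p; rewrite !mem_cat => /or3P[/imageP[[j l] _ ->]|/imageP[j _ ->]|].
- by rewrite evB evC ev_coordX /= c0 subrr.
- by rewrite evB !ev_traceX tc subrr.
by rewrite inE => /eqP->; rewrite evB evC ev_sum_coordX cl subrr.
Qed.

(** A symmetrised basis tensor; the disjunction keeps the value 1, not 2, when [a = b]. *)
Definition elem_tensor (a b d : 'I_n) : tensor k n := fun i j l =>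
  (((i == a) && (j == b) || (i == b) && (j == a)) && (l == d))%:R.

Lemma isC_elem a b d : isC (elem_tensor a b d).
Proof. by move=> i j l; rewrite /elem_tensor orbC ![_ && (j == _)]andbC. Qed.

Lemma trace_form0 i : trace_form (fun _ _ _ : 'I_n => 0 : k) 0 i = 0.
Proof. by rewrite mxE big1. Qed.

(** Each equation is compared at zero and at an elementary tensor that changes exactly one of its
    terms. *)
Lemma slice_eqs_nonconst p : p \in slice_eqs -> nonconst_on_C p.
Proof.
rewrite !mem_cat => /or3P[/imageP[[j l] _ ->]|/imageP[j _ ->]|].
- exists (elem_tensor ord0 (cur j) l), (fun _ _ _ => 0).
  split; [exact: isC_elem | split=> //].
  rewrite !evB !evC !ev_coordX /= (inj_eq (addIr _)) /elem_tensor !eqxx /=.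
  exact: oner_neq0.
- exists (elem_tensor (cur j) (cur j) (cur j)), (fun _ _ _ => 0).
  split; [exact: isC_elem | split=> //].
  rewrite !evB !ev_traceX !trace_form0 subrr.
  have nc : (nxt j == cur j) = false by rewrite -val_eqE /= /bump /=; lia.
  rewrite !mxE [X in _ - X]big1 => [|i _]; last first.
    by rewrite /elem_tensor nc.
  rewrite (bigD1 (cur j)) //= big1 ?addr0 => [|i /negPf ij].
    by rewrite /elem_tensor !eqxx subr0 oner_neq0.
  by rewrite /elem_tensor ij andbF.
rewrite inE => /eqP ->.
exists (elem_tensor ord0 ord_max ord0), (fun _ _ _ => 0).
split; [exact: isC_elem | split=> //].
rewrite !evB !evC (inj_eq (addIr _)) !ev_sum_coordX [X in _ != X]big1 //.
rewrite (bigD1 ord0) //= big1 ?addr0 => [|i /negPf ij].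
  by rewrite /elem_tensor !eqxx oner_neq0.
by rewrite /elem_tensor ij andbF.
Qed.

(** Take the Gram determinant times a numerator of the Krylov determinant; the first factor handles
    the locus where that fraction is not controlled. The product vanishes at the zero tensor, as [n]
    is positive, but not at [model]. *)
Lemma generic_eq : exists t : {mpoly k[Nvar n]},
  nonconst_on_C t /\ forall c, generic_pt c <-> ev t c != 0.
Proof.
have [d dE] := @polyfun_det_gram k n.
have [p [q pq]] : regular (fun c : {c : tensor k n | gram c \in unitmx} =>
    \det (krylov (sval c))).
  by apply: (fun_alg_det (regular_alg _)); apply: regular_krylov.
have tE c : generic_pt c <-> ev (p * d) c != 0.
  have uE : (gram c \in unitmx) = (\det (gram c) != 0).
    by rewrite unitmxE unitfE.
  rewrite evM mulf_eq0 negb_or dE -uE andbC.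
  split=> [[uc uW]|/andP[uc p0]].
    rewrite uc /=; have [q0] := pq (exist _ c uc) => /= detE.
    move: uW; rewrite unitmxE unitfE detE; apply: contraNneq => ->.
    by rewrite mul0r.
  split=> //; have [q0] := pq (exist _ c uc) => /= detE.
  by rewrite unitmxE unitfE detE mulf_neq0 ?invr_eq0.
exists (p * d); split=> //; exists model, (fun _ _ _ => 0).
split; [exact: isC_model | split=> //].
have -> : ev (p * d) (fun _ _ _ => 0) = 0; last by apply/tE/model_generic.
rewrite evM dE (_ : gram _ = 0) ?det0 ?mulr0 //.
by rewrite /gram big1 // => l _; rewrite trace_form0 scale0r.
Qed.

End Slice.

Lemma slice_line_closed (k : closedFieldType) m : line_closed (@in_slice k m).
Proof.
move=> x y t [Cx x0 tx xl] [Cy y0 ty yl].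
have tE i : trace_form (line x y t) 0 i =
    trace_form x 0 i + t * (trace_form y 0 i - trace_form x 0 i).
  by rewrite !mxE -sumrB mulr_sumr -big_split.
split=> [|j l|j|]; first exact: isC_line_closed.
- by rewrite /line x0 y0 subrr mulr0 addr0.
- by rewrite !tE tx ty.
- by rewrite /line big_split /= -mulr_sumr sumrB xl yl subrr mulr0 addr0.
Qed.

(** * Restriction of invariants to the slice *)

Section Restriction.
Variables (k : closedFieldType) (m : nat).
Local Notation n := m.+1.
Implicit Types (p q : {mpoly k[Nvar n]}) (x a : tensor k n).

Variable t : {mpoly k[Nvar n]}.
Hypothesis tP : forall c : tensor k n, generic_pt c <-> ev t c != 0.

Lemma in_sliceC x : in_slice x -> isC x.
Proof. by case. Qed.

Lemma nonzero_on_slice_t : nonzero_on (@in_slice k m) t.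
Proof.
by exists (@model k m); split; [exact: model_in_slice | exact/tP/model_generic].
Qed.

Lemma nonzero_on_sub (A B : tensor k n -> Prop) q :
  (forall x, A x -> B x) -> nonzero_on A q -> nonzero_on B q.
Proof. by move=> AB [x [/AB Bx qx]]; exists x. Qed.

(** The given [q] may vanish on the whole slice. Translating the fraction by [h = krylov a], for a
    generic [a] with [q] nonzero there, keeps its class by invariance, and the new denominator at
    [normal_form a] equals [q] at [a]. *)
Lemma restriction_defined p q : nonzero_on (@isC k n) q -> G_invariant p q ->
  exists p' q', nonzero_on (@in_slice k m) q' /\ eq_on (@isC k n) p q p' q'.
Proof.
move=> q0 inv.
have t0 := nonzero_on_sub in_sliceC nonzero_on_slice_t.
have [a [Ca]] := nonzero_onM (@isC_line_closed k n) q0 t0.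
rewrite evM mulf_eq0 negb_or => /andP[qa /tP ga].
have [_ uW] := ga; set h := krylov a in uW *.
have pull r : exists r', forall c, ev r' c = ev r (act h c).
  apply: (fun_alg_ev (@polyfun_alg k n)) => i j l; have algP := @polyfun_alg k n.
  do 3!apply: (fun_alg_sum algP) => ?.
  by case: algP => cstP _ mulP; do 3!apply: (mulP) => //; apply: polyfun_coord.
have [p' p'E] := pull p; have [q' q'E] := pull q.
exists p', q'; split=> [|x Cx]; last by rewrite p'E q'E inv.
exists (normal_form a); split; first exact: generic_in_slice.
by rewrite q'E /normal_form actVK.
Qed.

(** Invariance transports the equality from [normal_form a] to [a] on a dense open set;
    irreducibility of C extends it everywhere. *)
Lemma restriction_injective p q p' q' : G_invariant p q -> G_invariant p' q' ->
  nonzero_on (@in_slice k m) q -> nonzero_on (@in_slice k m) q' ->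
  eq_on (@in_slice k m) p q p' q' -> eq_on (@isC k n) p q p' q'.
Proof.
move=> inv inv' q0 q0' eqS.
(* Where [r] and [t] are nonzero, both denominators are nonzero at the normal form. *)
have [r [s rs]] := regular_ev_normal_form (q * q').
have r0 : nonzero_on (@isC k n) r.
  have qq't0 := nonzero_onM (@slice_line_closed k m)
    (nonzero_onM (@slice_line_closed k m) q0 q0') nonzero_on_slice_t.
  have [a [Sa]] := qq't0; rewrite evM mulf_eq0 negb_or => /andP[qq' /tP ga].
  exists a; split; first exact: in_sliceC.
  have [_ /=] := rs (exist _ a ga); rewrite normal_form_slice // => qqE.
  by apply: contraNneq qq' => r0; rewrite qqE r0 mul0r.
have key a : isC a -> ev r a != 0 -> ev t a != 0 ->
    ev p a * ev q' a = ev p' a * ev q a.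
  move=> Ca ra /tP ga.
  have : ev (q * q') (normal_form a) != 0.
    by have [s0 /= ->] := rs (exist _ a ga); rewrite mulf_neq0 ?invr_eq0.
  have [_ uW] := ga.
  have uV : invmx (krylov a) \in unitmx by rewrite unitmx_inv.
  rewrite evM => qq0; apply: (mulIf qq0).
  have := eqS _ (generic_in_slice Ca ga).
  move: (inv _ uV _ Ca) (inv' _ uV _ Ca); rewrite -/(normal_form a).
  set b := normal_form a; set P := ev p b; set P' := ev p' b.
  set Q := ev q b; set Q' := ev q' b.
  move=> pq p'q' PQ.
  transitivity ((ev p a * Q) * (ev q' a * Q')); first by ring.
  rewrite -pq; transitivity ((P * Q') * (ev q a * ev q' a)); first by ring.
  rewrite PQ; transitivity ((P' * ev q' a) * (Q * ev q a)); first by ring.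
  by rewrite p'q'; ring.
move=> x Cx; apply: NNPP => neq.
have d0 : nonzero_on (@isC k n) (p * q' - p' * q).
  exists x; split=> //; rewrite !evE; apply/eqP => /subr0_eq; exact: neq.
have t0 := nonzero_on_sub in_sliceC nonzero_on_slice_t.
have lC := @isC_line_closed k n.
(* A nonzero difference would stay nonzero at some point of the dense open set covered by [key]. *)
have [a [Ca]] := nonzero_onM lC d0 (nonzero_onM lC r0 t0).
rewrite !evE !mulf_eq0 !negb_or => /andP[da /andP[ra ta]].
by case/eqP: da; rewrite key // subrr.
Qed.

(* The denominators of [p] and [q] along the normal form are exchanged, so that
   [p' / q'] is the invariant extending [p / q], and the factor [t] makes both
   [p'] and [q'] vanish off the generic locus. *)
Lemma restriction_surjective p q : nonzero_on (@in_slice k m) q ->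
  exists p' q', G_invariant p' q' /\ nonzero_on (@in_slice k m) q' /\
                eq_on (@in_slice k m) p q p' q'.
Proof.
move=> q0; have [p1 [p2 pE]] := regular_ev_normal_form p.
have [q1 [q2 qE]] := regular_ev_normal_form q.
have pE' c : generic_pt c ->
    ev p2 c != 0 /\ ev p1 c = ev p (normal_form c) * ev p2 c.
  by move=> gc; have [p20 /= ->] := pE (exist _ c gc); rewrite divfK.
have qE' c : generic_pt c ->
    ev q2 c != 0 /\ ev q1 c = ev q (normal_form c) * ev q2 c.
  by move=> gc; have [q20 /= ->] := qE (exist _ c gc); rewrite divfK.
have nongeneric c : ~ generic_pt c -> ev t c = 0.
  by move=> ngc; apply/eqP; apply: contra_notT ngc => /tP.
exists (p1 * q2 * t), (q1 * p2 * t); split; last split.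
- move=> g ug x Cx; rewrite !evE.
  have [gx | /nongeneric ->] := classic (generic_pt x); last first.
    by rewrite !mulr0 mul0r.
  have ggx := generic_act ug gx.
  have [_ ->] := pE' _ gx; have [_ ->] := qE' _ gx.
  have [_ ->] := pE' _ ggx; have [_ ->] := qE' _ ggx.
  by rewrite normal_form_act //; ring.
(* A generic slice point where [q] is nonzero is its own normal form, so all three factors are
   nonzero there. *)
- have [a [Sa]] := nonzero_onM (@slice_line_closed k m) q0 nonzero_on_slice_t.
  rewrite evM mulf_eq0 negb_or => /andP[qa ta]; have ga := (tP a).2 ta.
  exists a; split=> //; rewrite !evE; have [_ ->] := qE' _ ga.
  have [p20 _] := pE' _ ga; have [q20 _] := qE' _ ga.
  by rewrite normal_form_slice // !mulf_neq0.
move=> x Sx; rewrite !evE.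
have [gx | /nongeneric ->] := classic (generic_pt x); last first.
  by rewrite !mulr0 mul0r.
have [_ ->] := pE' _ gx; have [_ ->] := qE' _ gx.
by rewrite normal_form_slice //; ring.
Qed.

End Restriction.

(** * Dimension zero and the assembly of the theorem *)

Lemma tensor0 (k : Type) (x y : tensor k 0) : x = y.
Proof. by apply: functional_extensionality => -[]. Qed.

Theorem theorem5 (k : closedFieldType) (n : nat) :
  (2%:R != 0 :> k) ->
  exists s t : seq {mpoly k[Nvar n]},
    (forall p, p \in s -> nonconst_on_C p) /\
    (forall q, q \in t -> nonconst_on_C q) /\
    let S : tensor k n -> Prop :=
      fun x => isC x /\ forall p, p \in s -> ev p x = 0 in
    (* (i) S is zariski_irreducible *)
    zariski_irreducible S /\
    (* restriction k(C)^G -> k(S) is well defined: every G_invariant f has a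
       representative whose denominator does not vanish identically on S *)
    (forall p q, nonzero_on (@isC k n) q -> G_invariant p q ->
       exists p' q', nonzero_on S q' /\ eq_on (@isC k n) p q p' q') /\
    (* ... and the restriction does not depend on the representative *)
    (forall p q p' q', G_invariant p q ->
       nonzero_on S q -> nonzero_on S q' ->
       eq_on (@isC k n) p q p' q' -> eq_on S p q p' q') /\
    (* injective *)
    (forall p q p' q', G_invariant p q -> G_invariant p' q' ->
       nonzero_on S q -> nonzero_on S q' ->
       eq_on S p q p' q' -> eq_on (@isC k n) p q p' q') /\
    (* surjective *)
    (forall p q, nonzero_on S q ->
       exists p' q', G_invariant p' q' /\ nonzero_on S q' /\
                     eq_on S p q p' q') /\
    (* (ii) the open set U is nonempty (hence dense, C being zariski_irreducible) *)
    (exists a : tensor k n, isC a /\ forall q, q \in t -> ev q a != 0) /\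
    (forall a : tensor k n, isC a -> (forall q, q \in t -> ev q a != 0) ->
       exists! g : 'M[k]_n, g \in unitmx /\ S (act g a)).
Proof.
move=> _; case: n => [|m].
  (* In dimension zero C is a single point with no nonconstant function, so both families must be
     empty. *)
  exists [::], [::]; do 2!split=> //; move=> S.
  pose o : tensor k 0 := fun _ _ _ => 0.
  have all_o x : x = o by apply: tensor0.
  have So : S o by [].
  split.
    apply: line_closed_irreducible => [|x y t _ _]; first by exists o.
    by rewrite [line _ _ _]all_o.
  split.
    move=> p q [x [_ qx]] _; exists p, q; split=> //; exists x.
    by rewrite (all_o x) in qx *.
  split; first by move=> p q p' q' _ _ _ eqC x [Cx _]; apply: eqC.
  split.
    by move=> p q p' q' _ _ _ _ eqS x _; apply: eqS; rewrite (all_o x).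
  split.
    move=> p q q0; exists p, q; split=> // g _ x _.
    by rewrite [act g x]all_o [x]all_o.
  split; first by exists o.
  move=> a _ _; exists 1%:M; split=> [|g _]; last first.
    by rewrite [1%:M]flatmx0 [g]flatmx0.
  by rewrite unitmx1 [act _ _]all_o.
have [t [t_nonconst tP]] := generic_eq k m.
exists (slice_eqs k m), [:: t]; split; first exact: slice_eqs_nonconst.
split=> [q|]; first by rewrite inE => /eqP->.
move=> S; have {S}-> : S = @in_slice k m.
  apply: functional_extensionality => x.
  exact/propositional_extensionality/slice_eqsP.
have tE (a : tensor k m.+1) :
    (forall q, q \in [:: t] -> ev q a != 0) <-> generic_pt a.
  split=> [ta | /tP ta q]; first by apply/tP/ta/mem_head.
  by rewrite inE => /eqP->.
split.
  apply: line_closed_irreducible (@slice_line_closed k m).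
  by exists (@model k m); apply: model_in_slice.
split; first exact: (restriction_defined tP).
split; first by move=> p q p' q' _ _ _ eqC x /in_sliceC; apply: eqC.
split; first exact: (restriction_injective tP).
split; first exact: (restriction_surjective tP).
split.
  by exists (@model k m); split; [exact: isC_model | exact/tE/model_generic].
move=> a Ca /tE ga; exists (invmx (krylov a)); split.
  by have [_ uW] := ga; rewrite unitmx_inv; split=> //; apply: generic_in_slice.
by move=> g [ug Sg]; apply/esym/generic_unique.
Qed.
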